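(* There exist constants $b>0$, $C>0$, $k_0$, $N_0$ such that for every integer $N\ge N_0$ there is a (deterministic) schedule $\mathcal S$ such that algorithm $\mathrm{SPoRD}(N;b,\mathcal S)$, in the setting without acknowledgments, has the following property: for every integer $k$ with $k_0\le k\le N$, under contention $k$ (i.e. for every set of at most $k$ activated stations and every wake-up pattern of these stations), any activated station $v$ transmits successfully within $C\,k^2\log N$ rounds from its activation.
   Context: Model. There are $N$ stations with distinct IDs from a set $[N]$ of size $N$, attached to a shared channel; time is divided into synchronous rounds. Each activated station is woken up in an arbitrary round; the set of activated stations and their activation times (the wake-up pattern) are chosen by a worst-case adversary. There is no global clock: a station activated in round $\tau$ has local round $r\ge1$ in global round $\tau+r-1$. A station transmits successfully in a round if it is the only station transmitting in that round. In the setting without acknowledgments stations get no feedback and do not switch off after a successful transmission. Algorithm $\mathrm{SPoRD}(N;b,\mathcal S)$ (non-adaptive; $k$ is not known). Let $T=\lceil b\ln N\rceil$. The schedule $\mathcal S$ consists of bits $\mathcal S_{v,i,j}\in\{0,1\}$ for each station $v$, each phase $i=1,\dots,16N^2$, and each $j=1,\dots,T$. An activated station $v$ transmits in round $(i-1)T+j$ of its local clock if and only if $\mathcal S_{v,i,j}=1$; after the last phase it is silent. *)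

(* Defs.v *)
From mathcomp Require Import all_boot all_order all_algebra.
From mathcomp Require Import reals exp.
Set Implicit Arguments.
Unset Strict Implicit.
Unset Printing Implicit Defensive.

Import Order.TTheory GRing.Theory Num.Theory.
Local Open Scope ring_scope.

Definition phase_count (N : nat) : nat := (16 * N ^ 2)%N.

(* The ceiling is nonnegative for 0 < b and 1 <= N, so the absolute value only
   casts it to nat. *)
Definition phase_length (R : realType) (b : R) (N : nat) : nat :=
  `|Num.ceil (b * ln N%:R)|%N.

(* [S v i j] with 0-based [i] and [j] is the bit of station [v] for position
   j + 1 of phase i + 1. *)
Definition schedule (R : realType) (b : R) (N : nat) : Type :=
  'I_N -> 'I_(phase_count N) -> 'I_(phase_length b N) -> bool.

Section SPoRD.
Variables (R : realType) (b : R) (N : nat) (S : schedule b N).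

(* Local rounds are numbered from 1: position j + 1 of phase i + 1 is local
   round i * T + (j + 1). In every other local round the station is silent. *)
Definition transmits_local (v : 'I_N) (r : nat) : bool :=
  [exists i : 'I_(phase_count N), exists j : 'I_(phase_length b N),
     (r == i * phase_length b N + j.+1)%N && S v i j].

(* A wake-up pattern consists of the set [A] of activated stations and the
   activation round [tau v] of each [v \in A]; the values of [tau] outside [A]
   are irrelevant. *)
Variables (A : {set 'I_N}) (tau : 'I_N -> nat).

(* Global round t is local round t - tau v + 1 of [v]. There is no feedback:
   the behaviour of [v] does not depend on earlier successes. *)
Definition transmits (v : 'I_N) (t : nat) : bool :=
  [&& v \in A, (tau v <= t)%N & transmits_local v (t - tau v).+1].

Definition transmits_successfully (v : 'I_N) (t : nat) : bool :=
  transmits v t && [forall u, (u != v) ==> ~~ transmits u t].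

(* Local round r >= 1 of [v] is global round tau v + r - 1. *)
Definition succeeds_within (v : 'I_N) (B : R) : Prop :=
  exists r : nat,
    [/\ (1 <= r)%N, r%:R <= B & transmits_successfully v (tau v + r - 1)%N].

End SPoRD.

(* Main.v *)
Require Import Defs.
From mathcomp Require Import all_boot all_order all_algebra.
From mathcomp Require Import reals sequences exp.
From mathcomp Require Import zify ring lra.
Import Order.TTheory GRing.Theory Num.Theory.
Local Open Scope ring_scope.

(* Each station transmits in its local round x + 1 with probability
   sqrt (T / (x + T)) / 16, independently over stations and rounds. For
   contention k look only at the local rounds between 4 k^2 T and 12 k^2 T of a
   station v, where this probability is of order 1/k. In this window v makes order k T transmissions,
   while another station u, however shifted, collides with a number of them of
   order T, with a constant small enough that, up to probability
   exp (- T / 32), fewer than a fraction 1/k of the transmissions of v collide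
   with u. A union bound over v, u, the shift and k gives one schedule for which
   this always holds, and then the at most k - 1 other stations cannot spoil
   all transmissions of v. *)

Set Implicit Arguments.
Unset Strict Implicit.
Unset Printing Implicit Defensive.

(** * Expectations over independent biased bits, as finite weighted sums *)

Definition bernoulli_weight (R : realType) (X : finType) (p : X -> R)
    (a : {ffun X -> bool}) : R :=
  \prod_x (if a x then p x else 1 - p x).

(** Independence: the mean of a product is the product of the means. Each factor is written as 1
    plus a deviation, ready for 1 + y <= exp y. *)
Lemma bernoulli_prod (R : realType) (X : finType) (p : X -> R)
    (F : X -> bool -> R) :
  \sum_a bernoulli_weight p a * \prod_x F x (a x) =
  \prod_x (1 + p x * (F x true - 1) + (1 - p x) * (F x false - 1)).
Proof.
transitivity (\prod_x \sum_(j : bool) (if j then p x else 1 - p x) * F x j).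
  rewrite bigA_distr_bigA; apply: eq_bigr => a _.
  by rewrite /bernoulli_weight -big_split.
by apply: eq_bigr => x _; rewrite big_bool /=; ring.
Qed.

Lemma bernoulli_weight_ge0 (R : realType) (X : finType) (p : X -> R)
    (a : {ffun X -> bool}) :
  (forall x, 0 <= p x <= 1) -> 0 <= bernoulli_weight p a.
Proof.
move=> p01; apply: prodr_ge0 => x _; have /andP[p0 p1] := p01 x.
by case: ifP; rewrite ?subr_ge0.
Qed.

Lemma bernoulli_weight_sum1 (R : realType) (X : finType) (p : X -> R) :
  \sum_a bernoulli_weight p a = 1.
Proof.
have /= := bernoulli_prod p (fun _ _ => 1).
under eq_bigr do rewrite big1 // mulr1.
by move=> ->; apply: big1 => x _; rewrite !subrr !mulr0 !addr0.
Qed.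

Lemma product_weight_sum1 (R : comPzRingType) (I J : finType) (w : J -> R) :
  \sum_j w j = 1 -> \sum_(f : {ffun I -> J}) \prod_z w (f z) = 1.
Proof.
move=> w1; rewrite -(bigA_distr_bigA (fun _ : I => w)).
by rewrite big1 // => i _.
Qed.

(** Expanding [g] over the indicators of the values at [v] and [u] turns each summand into a product
    over coordinates; all coordinates other than [u] and [v] then sum to 1. *)
Lemma product_weight_marginal2 (R : comPzRingType) (I J : finType)
    (w : J -> R) (u v : I) (g : J -> J -> R) :
  \sum_j w j = 1 -> u != v ->
  \sum_(f : {ffun I -> J}) (\prod_z w (f z)) * g (f v) (f u) =
  \sum_a \sum_c w a * w c * g a c.
Proof.
move=> w1 uv.
pose F a c z d : R := w d * (if z == v then (d == a)%:R
                            else if z == u then (d == c)%:R else 1).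
have Fsum a c : \sum_(f : {ffun I -> J}) \prod_z F a c z (f z) = w a * w c.
  rewrite -(bigA_distr_bigA (F a c)) (bigD1 v) //= (bigD1 u) //=.
  rewrite [X in _ * (_ * X)]big1 ?mulr1; last first.
    move=> z /andP[zv zu]; rewrite /F (negbTE zv) (negbTE zu).
    by under eq_bigr do rewrite mulr1.
  rewrite /F eqxx (negbTE uv) eqxx; congr (_ * _).
  - rewrite (bigD1 a) //= eqxx mulr1 big1 ?addr0 // => d /negbTE ->.
    by rewrite mulr0.
  - rewrite (bigD1 c) //= eqxx mulr1 big1 ?addr0 // => d /negbTE ->.
    by rewrite mulr0.
transitivity (\sum_(f : {ffun I -> J}) \sum_a \sum_c
                 (\prod_z F a c z (f z)) * g a c).
  apply: eq_bigr => f _.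
  have Fz a c : (a != f v) || (c != f u) -> \prod_z F a c z (f z) = 0.
    rewrite /F => /orP[/negbTE av|/negbTE cu].
      by rewrite (bigD1 v) //= eqxx [f v == a]eq_sym av mulr0 mul0r.
    rewrite (bigD1 v) //= (bigD1 u) //= (negbTE uv) eqxx.
    by rewrite eqxx [f u == c]eq_sym cu mulr0 mul0r mulr0.
  rewrite (bigD1 (f v)) //= (bigD1 (f u)) //= [X in _ + X + _]big1; last first.
    by move=> c cu; rewrite Fz ?mul0r // cu orbT.
  rewrite [X in _ + X]big1 ?addr0; last first.
    by move=> a av; rewrite big1 // => c _; rewrite Fz ?mul0r // av.
  congr (_ * _); apply: eq_bigr => z _; rewrite /F.
  by case: eqP => [->|_]; rewrite ?eqxx ?mulr1 //; case: eqP => [->|_];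
    rewrite ?eqxx ?mulr1.
rewrite exchange_big; apply: eq_bigr => a _.
rewrite exchange_big; apply: eq_bigr => c _.
by rewrite -mulr_suml Fsum.
Qed.

(** Since 1 - x <= exp (- x), one has (1 - x) exp x <= 1 <= (1 - x)(1 + 2x), the last inequality by
    x <= 1/2. *)
Lemma expR_le1D2x (R : realType) (x : R) : 0 <= x <= 2^-1 ->
  expR x <= 1 + 2 * x.
Proof.
move=> /andP[x0 x2]; have h := expR_ge1Dx (- x).
have : (1 - x) * expR x <= 1.
  by rewrite -[leRHS](expRxMexpNx_1 x) mulrC ler_pM2l ?expR_gt0.
have h1 : 1 <= (1 - x) * (1 + 2 * x) by nra.
by move=> /le_trans /(_ h1); rewrite ler_pM2l; lra.
Qed.

Lemma prod_1Dx_le_expR (R : realType) (X : finType) (P : pred X) (y : X -> R) :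
  (forall x, P x -> -1 <= y x) ->
  \prod_(x | P x) (1 + y x) <= expR (\sum_(x | P x) y x).
Proof.
move=> y1; rewrite expR_sum; apply: ler_prod => x Px.
by rewrite expR_ge1Dx andbT -lerBlDl sub0r y1.
Qed.

(** * Exponential moment of the collisions between two stations *)

Definition hits (X : finType) (e : rel X) (c : {ffun X -> bool}) (x : X) :=
  [exists y, e x y && c y].

(* Markov statistic: with A = 1 - 1/(2k) we have 2 A^k >= 1, so A^n 2^m >= 1 as
   soon as n <= k m. *)
Definition collision_moment (R : realType) (X : finType) (W : pred X)
    (e : rel X) (k : nat) (a c : {ffun X -> bool}) : R :=
  (1 - (2 * k%:R)^-1) ^+ #|[pred x | W x && a x]| *
  2 ^+ #|[pred x | [&& W x, a x & hits e c x]]|.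

Lemma collision_moment_ge0 (R : realType) (X : finType) (W : pred X)
    (e : rel X) (k : nat) (a c : {ffun X -> bool}) : (0 < k)%N ->
  0 <= collision_moment R W e k a c.
Proof.
move=> k0; have k1 : (1 : R) <= k%:R by rewrite ler1n.
rewrite /collision_moment mulr_ge0 ?exprn_ge0 // subr_ge0 invf_le1; lra.
Qed.

Lemma collision_moment_ge1 (R : realType) (X : finType) (W : pred X)
    (e : rel X) (k : nat) (a c : {ffun X -> bool}) : (0 < k)%N ->
  (#|[pred x | W x && a x]| <=
     k * #|[pred x | [&& W x, a x & hits e c x]]|)%N ->
  1 <= collision_moment R W e k a c.
Proof.
move=> k0; have k1 : (1 : R) <= k%:R by rewrite ler1n.
rewrite /collision_moment; set n := #|_|; set m := #|_| => nkm.
set A := 1 - _.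
have A0 : 0 <= A by rewrite subr_ge0 invf_le1; lra.
have A1 : A <= 1 by rewrite gerBl invr_ge0; lra.
have AK : 2^-1 <= A ^+ k.
  have t0 : 0 <= (2 * k%:R)^-1 :> R by rewrite invr_ge0; lra.
  (* Bernoulli's inequality; for j = k its left side is 1/2. *)
  have bern j : 1 - j%:R * (2 * k%:R)^-1 <= A ^+ j.
    elim: j => [|j IH]; first by rewrite mul0r subr0.
    have j0 : (0 : R) <= j%:R by [].
    rewrite exprS -natr1; apply: le_trans (ler_wpM2l A0 IH).
    by rewrite /A; move: (_^-1) t0 => t t0; nra.
  apply: le_trans (bern k); rewrite invfM mulrCA divff ?mulr1; lra.
apply: le_trans (ler_wpM2r _ (ler_wiXn2l A0 A1 nkm)); last exact: exprn_ge0.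
by rewrite exprM -exprMn exprn_ege1 //; lra.
Qed.

(** Averaging over [a] for fixed [c] leaves exp of the hit window positions weighted by [p], minus a
    drift. Counting matched transmissions instead of hits makes this a product over the bits of [c],
    which is averaged next. *)
Lemma collision_moment_mean (R : realType) (X : finType) (p : X -> R)
    (W : pred X) (e : rel X) (k : nat) :
  (0 < k)%N -> (forall x, 0 <= p x <= 1) ->
  (forall y, \sum_(x | W x && e x y) p x <= 2^-1) ->
  \sum_a \sum_c bernoulli_weight p a * bernoulli_weight p c *
    collision_moment R W e k a c <=
  expR (2 * (\sum_y p y * \sum_(x | W x && e x y) p x)
        - (2 * k%:R)^-1 * \sum_(x | W x) p x).
Proof.
move=> k0 p01 q2; have k1 : (1 : R) <= k%:R by rewrite ler1n.
set A : R := 1 - (2 * k%:R)^-1.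
have A0 : 0 <= A by rewrite subr_ge0 invf_le1; lra.
have iA : 0 <= (2 * k%:R)^-1 :> R by rewrite invr_ge0; lra.
pose q y := \sum_(x | W x && e x y) p x.
have q0 y : 0 <= q y by apply: sumr_ge0 => x _; case/andP: (p01 x).
rewrite exchange_big /=.
set D : R := (2 * k%:R)^-1 * \sum_(x | W x) p x.
have inner c : \sum_a bernoulli_weight p a * bernoulli_weight p c *
      collision_moment R W e k a c <=
    bernoulli_weight p c * (expR (- D) * \prod_y expR ((c y)%:R * q y)).
  pose F x (z : bool) : R :=
    if W x && z then A * (if hits e c x then 2 else 1) else 1.
  have -> : \sum_a bernoulli_weight p a * bernoulli_weight p c *
      collision_moment R W e k a c =
      bernoulli_weight p c * \sum_a bernoulli_weight p a * \prod_x F x (a x).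
    rewrite mulr_sumr; apply: eq_bigr => a _.
    rewrite -mulrA mulrCA; congr (_ * (_ * _)).
    rewrite /collision_moment -!prodr_const -/A /F.
    rewrite big_mkcond [X in _ * X]big_mkcond -big_split /=.
    apply: eq_bigr => x _; rewrite !inE andbA.
    by case: (W x && a x) => /=; rewrite ?mulr1 //; case: ifP.
  rewrite ler_wpM2l ?bernoulli_weight_ge0 // bernoulli_prod.
  rewrite -expR_sum -expRD.
  pose h x : R := p x * ((hits e c x)%:R - (2 * k%:R)^-1).
  have -> : \prod_x (1 + p x * (F x true - 1) + (1 - p x) * (F x false - 1))
      = \prod_(x | W x) (1 + p x * (A * (if hits e c x then 2 else 1) - 1)).
    rewrite [RHS]big_mkcond; apply: eq_bigr => x _.
    by rewrite /F andbF andbT subrr mulr0 addr0; case: (W x); rewrite // subrr mulr0 addr0.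
  apply: le_trans (prod_1Dx_le_expR _) _ => [x Wx|].
    have /andP[p0 p1] := p01 x.
    have : 0 <= A * (if hits e c x then 2 else 1).
      by rewrite mulr_ge0 //; case: ifP.
    by move: (A * _) => z z0; nra.
  rewrite ler_expR addrC lerBrDr.
  have -> : \sum_y (c y)%:R * q y =
      \sum_(x | W x) \sum_(y | e x y) (c y)%:R * p x.
    under eq_bigr do rewrite mulr_sumr.
    rewrite (exchange_big_dep W) /= => [|y x _ /andP[]//].
    by apply: eq_bigr => x Wx; apply: eq_bigl => y; rewrite Wx.
  rewrite /D mulr_sumr -big_split; apply: ler_sum => x Wx /=.
  have /andP[p0 p1] := p01 x.
  have s0 : 0 <= \sum_(y | e x y) (c y)%:R * p x.
    by apply: sumr_ge0 => y _; rewrite mulr_ge0.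
  rewrite /A; move: (_^-1) iA => t t0.
  (* A hit at [x] comes from some matched [y] with [c y], so the sum over [y] is at least [p x]. *)
  case: ifP => [/existsP[y /andP[exy cy]]|_]; last by nra.
  have : p x <= \sum_(y | e x y) (c y)%:R * p x.
    rewrite (bigD1 y) //= cy mul1r lerDl sumr_ge0 // => z _.
    by rewrite mulr_ge0.
  by move: s0; set s := \sum_(_ | _) _; nra.
apply: le_trans (ler_sum _ (fun c _ => inner c)) _.
rewrite [leLHS](_ : _ = expR (- D) * \sum_c bernoulli_weight p c *
    \prod_y expR ((c y)%:R * q y)); last first.
  by rewrite mulr_sumr; apply: eq_bigr => c _; rewrite mulrCA.
rewrite addrC expRD ler_wpM2l ?expR_ge0 //.
rewrite (bernoulli_prod p (fun y z => expR (z%:R * q y))) mulr_sumr.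
rewrite expR_sum; apply: ler_prod => y _.
have /andP[p0 p1] := p01 y.
rewrite mul0r expR0 subrr mulr0 addr0 mul1r.
(* The mean over the bit [c y] is 1 + p (exp q - 1) <= 1 + 2pq <= exp (2pq). *)
have e1 : 1 <= expR (q y) by rewrite -expR0 ler_expR.
have e2 : expR (q y) <= 1 + 2 * q y by apply: expR_le1D2x; rewrite q0 q2.
apply/andP; split; first by nra.
apply: le_trans (expR_ge1Dx _); rewrite -/(q y); nra.
Qed.

(** * Estimates of the transmission probability *)

Definition density (R : realType) (T x : nat) : R :=
  Num.sqrt T%:R / (16 * Num.sqrt (x + T)%:R).

Lemma sqrt_natX2M (R : realType) (m T : nat) :
  Num.sqrt (m ^ 2 * T)%:R = m%:R * Num.sqrt T%:R :> R.
Proof. by rewrite natrM sqrtrM // natrX sqrtr_sqr normr_nat. Qed.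

Lemma density_itv01 (R : realType) (T x : nat) : (0 < T)%N ->
  0 <= density R T x <= 1.
Proof.
move=> T0; rewrite /density.
have s0 : 0 < Num.sqrt (x + T)%:R :> R.
  by rewrite sqrtr_gt0 ltr0n addn_gt0 T0 orbT.
have s1 : Num.sqrt T%:R <= Num.sqrt (x + T)%:R :> R.
  by rewrite ler_wsqrtr // ler_nat leq_addl.
have s2 := sqrtr_ge0 (T%:R : R).
apply/andP; split; first by rewrite divr_ge0 // mulr_ge0 // ltW.
by rewrite ler_pdivrMr ?mulr_gt0 //; lra.
Qed.

Lemma density_le (R : realType) (T k x : nat) : (0 < T)%N -> (0 < k)%N ->
  (4 * k ^ 2 * T <= x)%N -> density R T x <= (32 * k%:R)^-1.
Proof.
move=> T0 k0 kx; have k1 : (1 : R) <= k%:R by rewrite ler1n.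
have s1 : (2 * k)%:R * Num.sqrt T%:R <= Num.sqrt (x + T)%:R :> R.
  by rewrite -sqrt_natX2M ler_wsqrtr // ler_nat expnMn; lia.
have t0 : 0 < Num.sqrt T%:R :> R by rewrite sqrtr_gt0 ltr0n.
rewrite natrM in s1.
have s0 : 0 < Num.sqrt (x + T)%:R :> R.
  by rewrite sqrtr_gt0 ltr0n addn_gt0 T0 orbT.
rewrite /density ler_pdivrMr ?mulr_gt0 // mulrC ler_pdivlMr; nra.
Qed.

(** Here x + T <= 16 k^2 T, so its root is at most 4 k sqrt T. Together with [density_le] this pins
    the density in the window down to a factor 2. *)
Lemma density_ge (R : realType) (T k x : nat) : (0 < T)%N -> (0 < k)%N ->
  (x < 12 * k ^ 2 * T)%N -> (64 * k%:R)^-1 <= density R T x.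
Proof.
move=> T0 k0 kx; have k1 : (1 : R) <= k%:R by rewrite ler1n.
have kk : (T <= k ^ 2 * T)%N by rewrite leq_pmull // expn_gt0 k0.
have s1 : Num.sqrt (x + T)%:R <= (4 * k)%:R * Num.sqrt T%:R :> R.
  by rewrite -sqrt_natX2M ler_wsqrtr // ler_nat expnMn; lia.
rewrite natrM in s1.
have s0 : 0 < Num.sqrt (x + T)%:R :> R.
  by rewrite sqrtr_gt0 ltr0n addn_gt0 T0 orbT.
rewrite /density ler_pdivlMr ?mulr_gt0 // mulrC ler_pdivrMr; nra.
Qed.

Lemma density_decr (R : realType) (T x y : nat) : (0 < T)%N -> (x <= y)%N ->
  density R T y <= density R T x.
Proof.
move=> T0 xy; rewrite /density ler_wpM2l ?sqrtr_ge0 //.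
have s0 z : 0 < Num.sqrt (z + T)%:R :> R.
  by rewrite sqrtr_gt0 ltr0n addn_gt0 T0 orbT.
rewrite lef_pV2 ?posrE ?mulr_gt0 // ler_pM2l // ler_wsqrtr // ler_nat.
by rewrite leq_add2r.
Qed.

(** The inverse root of x + 1 is at most 2 (sqrt (x + 1) - sqrt x), so sums of densities
    telescope. *)
Lemma density_le_diff (R : realType) (T x : nat) : (0 < T)%N ->
  density R T x <=
  Num.sqrt T%:R / 8 * (Num.sqrt x.+1%:R - Num.sqrt x%:R).
Proof.
move=> T0; rewrite /density.
have t0 := sqrtr_ge0 (T%:R : R).
rewrite -!mulrA ler_wpM2l //.
have x0 : 0 < Num.sqrt x.+1%:R :> R by rewrite sqrtr_gt0.
have xT : Num.sqrt x.+1%:R <= Num.sqrt (x + T)%:R :> R.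
  by rewrite ler_wsqrtr // ler_nat -addn1 leq_add2l.
apply: (@le_trans _ _ (16 * Num.sqrt x.+1%:R)^-1).
  by rewrite lef_pV2 ?posrE ?mulr_gt0 ?ler_pM2l //; apply: lt_le_trans xT.
rewrite invfM; set a := Num.sqrt x.+1%:R; set b := Num.sqrt x%:R.
have a2 : a ^+ 2 = x%:R + 1 by rewrite /a sqr_sqrtr // natr1.
have b2 : b ^+ 2 = x%:R by rewrite /b sqr_sqrtr.
have b0 : 0 <= b by apply: sqrtr_ge0.
have ba : b <= a by rewrite ler_wsqrtr // ler_nat.
have : a^-1 <= 2 * (a - b); last by lra.
rewrite -[leLHS]mul1r ler_pdivrMr //; nra.
Qed.

(** The density decreases, so among all shifts the largest sum is the one that starts at position 0,
    and this one telescopes. *)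
Lemma sum_density_shift (R : realType) (T n d l : nat) : (0 < T)%N ->
  \sum_(j < n) (if (d <= j + l)%N then density R T (j + l - d) else 0) <=
  Num.sqrt T%:R / 8 * Num.sqrt n%:R.
Proof.
move=> T0; have t0 : 0 <= Num.sqrt T%:R / 8 :> R by rewrite divr_ge0 ?sqrtr_ge0.
(* Strengthened for the induction: with truncated subtraction, [n - (d - l)] counts the indices that
   satisfy the condition. *)
apply: (@le_trans _ _ (Num.sqrt T%:R / 8 * Num.sqrt (n - (d - l))%:R)); last first.
  by rewrite ler_wpM2l // ler_wsqrtr // ler_nat leq_subr.
elim: n => [|n IH]; first by rewrite big_ord0 mulr_ge0 ?sqrtr_ge0.
rewrite big_ord_recr /=; case: leqP => dn.
  have -> : (n.+1 - (d - l) = (n - (d - l)).+1)%N by lia.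
  have h := density_le_diff R (n - (d - l)) T0.
  have h' : density R T (n + l - d) <= density R T (n - (d - l)).
    by apply: density_decr => //; lia.
  by move: IH h h'; rewrite mulrBr; lra.
rewrite addr0; apply: le_trans IH _.
by rewrite ler_wpM2l // ler_wsqrtr // ler_nat leq_sub2r.
Qed.

(** * The exponent for one window and one shift *)

Definition window (T k x : nat) : bool := (4 * k ^ 2 * T <= x < 12 * k ^ 2 * T)%N.

(* The relative shift s = tau v + P - tau u of two local clocks is offset by P and
   capped at 2 P: beyond either end the P-round schedules do not overlap. *)
Definition matched (P s : nat) : rel 'I_P := 
  fun x y : 'I_P => (y + P == x + s)%N.

Lemma big_window (R : realType) (P T k : nat) (F : nat -> R) :
  (12 * k ^ 2 * T <= P)%N ->
  \sum_(x : 'I_P | window T k x) F x =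
  \sum_(j < 8 * k ^ 2 * T) F (j + 4 * k ^ 2 * T)%N.
Proof.
move=> kP; rewrite -(big_mkord (window T k) F).
rewrite -(big_mkord xpredT (fun j => F (j + _)%N)).
rewrite (@big_cat_nat _ _ _ (12 * k ^ 2 * T)%N) //= [X in _ + X]big1_seq; last first.
  by move=> x; rewrite mem_index_iota /window; lia.
rewrite addr0 (@big_cat_nat _ _ _ (4 * k ^ 2 * T)%N) //=; last by lia.
rewrite [X in X + _]big1_seq ?add0r; last first.
  by move=> x; rewrite mem_index_iota /window; lia.
rewrite -[X in \sum_(X <= _ < _ | _) _]add0n big_addn.
apply: congr_big_nat => // [|j]; first by lia.
by rewrite /window; lia.
Qed.

(** The 8 k^2 T window positions have density at least 1/(64k), total at least kT/8, so the drift is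
    at least T/16. The densities of the other station over the window sum to at most kT/2; times
    1/(32k) and 2 this costs at most T/32. *)
Lemma window_exponent (R : realType) (P T k s : nat) :
  (0 < T)%N -> (0 < k)%N -> (12 * k ^ 2 * T <= P)%N ->
  let p (x : 'I_P) := density R T x in
  let q y := \sum_(x : 'I_P | window T k x && matched s x y) p x in
  (forall y, q y <= 2^-1) /\
  2 * (\sum_y p y * q y) - (2 * k%:R)^-1 * \sum_(x : 'I_P | window T k x) p x
    <= - (T%:R / 32).
Proof.
move=> T0 k0 kP p q; have k1 : (1 : R) <= k%:R by rewrite ler1n.
(* At most one [x] is matched with a given [y], so [q y] is a single window density or 0. *)
have qle y : q y <= (32 * k%:R)^-1.
  rewrite /q; case: (pickP [pred x : 'I_P | window T k x && matched s x y]).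
    move=> x /andP[/andP[x1 x2] /eqP xy].
    rewrite (big_pred1 x) ?density_le // => z /=.
    apply/andP/eqP => [[_ /eqP zy]|->]; last first.
      by rewrite /window x1 x2; split=> //; apply/eqP.
    by apply: val_inj => /=; lia.
  by move=> none; rewrite big_pred0 // invr_ge0 mulr_ge0.
have q2 y : q y <= 2^-1.
  apply: le_trans (qle y) _; rewrite lef_pV2 ?posrE; lra.
split=> //.
have gain : T%:R / 8 * k%:R <= \sum_(x : 'I_P | window T k x) p x.
  rewrite big_window //.
  apply: (@le_trans _ _ (\sum_(j < 8 * k ^ 2 * T) (64 * k%:R)^-1)); last first.
    by apply: ler_sum => j _; apply: density_ge => //; have := ltn_ord j; lia.
  rewrite sumr_const card_ord -[leRHS]mulr_natr !natrM.
  by rewrite le_eqVlt; apply/orP; left; apply/eqP; field; lra.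
have coll : \sum_(x : 'I_P | window T k x) \sum_(y | matched s x y) p y <=
    T%:R / 2 * k%:R.
  (* The density at the only possible match of [x], kept even if that position is beyond [P]; this
     can only enlarge the sum. *)
  pose G x := if (P <= x + s)%N then density R T (x + s - P) else 0.
  apply: (@le_trans _ _ (\sum_(x : 'I_P | window T k x) G x)).
    apply: ler_sum => x _; rewrite /G.
    case: (pickP [pred y : 'I_P | matched s x y]) => [y /eqP yx|none].
      rewrite (big_pred1 y) /=.
        have -> : (P <= x + s)%N by lia.
        by rewrite /p (_ : x + s - P = y)%N //; lia.
      move=> z; apply/eqP/eqP => [zy|->//].
      by apply: val_inj => /=; lia.
    by rewrite big_pred0 //; case: ifP => // _; case/andP: (density_itv01 R (x + s - P) T0).
  rewrite big_window // /G; under eq_bigr do rewrite -addnA.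
  apply: le_trans (sum_density_shift _ _ _ _ T0) _.
  have h : Num.sqrt (8 * k ^ 2 * T)%:R <= 4 * k%:R * Num.sqrt T%:R :> R.
    by rewrite -natrM -sqrt_natX2M ler_wsqrtr // ler_nat expnMn; lia.
  have tt : Num.sqrt T%:R ^+ 2 = T%:R :> R by rewrite sqr_sqrtr.
  have := sqrtr_ge0 (T%:R : R).
  move: h; rewrite -{4}tt; nra.
have cross : \sum_y p y * q y <= T%:R / 64.
  apply: (@le_trans _ _ ((32 * k%:R)^-1 *
      \sum_(x : 'I_P | window T k x) \sum_(y | matched s x y) p y)).
    rewrite mulr_sumr /q.
    under eq_bigr do rewrite mulr_sumr.
    rewrite (exchange_big_dep (fun x : 'I_P => window T k x)) /= => [|y x _ /andP[]//].
    apply: ler_sum => x Wx; rewrite mulr_sumr Wx /=.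
    apply: ler_sum => y _; rewrite mulrC ler_wpM2r //.
      by case/andP: (density_itv01 R y T0).
    by apply: density_le => //; case/andP: Wx.
  apply: (@le_trans _ _ ((32 * k%:R)^-1 * (T%:R / 2 * k%:R))).
    by rewrite ler_wpM2l // invr_ge0; lra.
  by rewrite le_eqVlt; apply/orP; left; apply/eqP; field; lra.
have : T%:R / 16 <= (2 * k%:R)^-1 * \sum_(x : 'I_P | window T k x) p x.
  apply: (@le_trans _ _ ((2 * k%:R)^-1 * (T%:R / 8 * k%:R))).
    by rewrite le_eqVlt; apply/orP; left; apply/eqP; field; lra.
  by rewrite ler_wpM2l // invr_ge0; lra.
by move: cross; lra.
Qed.

(** * First moment method and union bound *)

Lemma exists_lt1_of_mean (R : realType) (Y : finType) (w Z : Y -> R) :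
  (forall y, 0 <= w y) -> \sum_y w y = 1 -> \sum_y w y * Z y < 1 ->
  exists y, Z y < 1.
Proof.
move=> w0 w1 lt1; apply/existsP; apply: contraTT lt1 => /existsPn Zge.
rewrite -leNgt -w1; apply: ler_sum => y _.
by rewrite -[leLHS]mulr1 ler_wpM2l // leNgt.
Qed.

(** Quantifying over the shift [s] of one pair instead of whole wake-up patterns leaves only
    polynomially many conditions. Strictness also forces [v] to transmit in the window. *)
Definition sparse_collisions (N T P : nat)
    (f : {ffun 'I_N -> {ffun 'I_P -> bool}}) : Prop :=
  forall u v : 'I_N, u != v -> forall s k : nat,
  (s <= 2 * P)%N -> (0 < k <= N)%N ->
  (k * #|[pred x : 'I_P | [&& window T k x, f v x & hits (matched s) (f u) x]]|
     < #|[pred x : 'I_P | window T k x && f v x]|)%N.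

(** There are at most N^3 (2P + 1) choices of two stations, shift and k, each with mean moment at
    most exp (- T/32). Hence some outcome has total moment below 1, whereas a single violated
    condition would contribute at least 1. *)
Lemma exists_sparse_collisions (R : realType) (N T P : nat) :
  (0 < T)%N -> (12 * N ^ 2 * T <= P)%N ->
  (N ^ 3 * (2 * P + 1))%:R * expR (- (T%:R / 32)) < 1 :> R ->
  exists f, @sparse_collisions N T P f.
Proof.
move=> T0 NP small.
pose p (x : 'I_P) : R := density R T x.
have p01 x : 0 <= p x <= 1 by apply: density_itv01.
pose w := bernoulli_weight p.
(* The last component stores k - 1. *)
pose Idx : finType := ('I_N * 'I_N * 'I_(2 * P).+1 * 'I_N)%type.
pose Zt (t : Idx) (a c : {ffun 'I_P -> bool}) : R :=
  collision_moment R (fun x : 'I_P => window T t.2.+1 x) (matched t.1.2) t.2.+1 a c.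
pose off (t : Idx) := t.1.1.1 != t.1.1.2.
pose Z (f : {ffun 'I_N -> {ffun 'I_P -> bool}}) :=
  \sum_(t | off t) Zt t (f t.1.1.2) (f t.1.1.1).
have Zt0 t a c : 0 <= Zt t a c by apply: collision_moment_ge0.
have [|||f Zf] := @exists_lt1_of_mean _ _ (fun f : {ffun 'I_N -> _} => \prod_z w (f z)) Z.
- by move=> f; apply: prodr_ge0 => z _; apply: bernoulli_weight_ge0.
- by apply: product_weight_sum1; apply: bernoulli_weight_sum1.
- apply: le_lt_trans small; under eq_bigr do rewrite mulr_sumr.
  rewrite exchange_big /=.
  apply: (@le_trans _ _ (\sum_(t : Idx | off t) expR (- (T%:R / 32)))).
    apply: ler_sum => t offt.
    rewrite (product_weight_marginal2 (Zt t)) ?bernoulli_weight_sum1 //.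
    have kP : (12 * t.2.+1 ^ 2 * T <= P)%N.
      by apply: leq_trans NP; rewrite !leq_mul2r leq_mul2l leq_sqr ltn_ord !orbT.
    have [q2 expo] := window_exponent R t.1.2 T0 (ltn0Sn t.2) kP.
    by apply: le_trans (collision_moment_mean (ltn0Sn t.2) p01 q2) _;
      rewrite ler_expR; apply: expo.
  rewrite sumr_const -[leLHS]mulr_natl ler_wpM2r ?expR_ge0 // ler_nat.
  apply: leq_trans (max_card _) _.
  by rewrite !card_prod !card_ord; lia.
exists f => u v uv s k sP /andP[k0 kN]; rewrite ltnNge; apply/negP => bad.
have sP' : (s < (2 * P).+1)%N by lia.
have kN' : (k.-1 < N)%N by lia.
pose t : Idx := (u, v, Ordinal sP', Ordinal kN').
move: Zf; rewrite ltNge => /negP; apply.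
rewrite /Z (bigD1 t) //= -[leLHS]addr0 lerD ?sumr_ge0 //.
by rewrite /Zt /= prednK //; apply: collision_moment_ge1.
Qed.

(** * From sparse collisions to a successful transmission *)

Definition schedule_of_bits (R : realType) (b : R) (N : nat)
    (f : {ffun 'I_N -> {ffun 'I_(phase_count N * phase_length b N) -> bool}}) :
    schedule b N :=
  fun v i j => [exists y : 'I__, (y == i * phase_length b N + j :> nat)%N && f v y].

Lemma transmits_local_bits (R : realType) (b : R) (N : nat)
    (f : {ffun 'I_N -> {ffun 'I_(phase_count N * phase_length b N) -> bool}})
    (v : 'I_N) (x : nat) :
  transmits_local (schedule_of_bits f) v x.+1 =
  [exists y : 'I__, (y == x :> nat) && f v y].
Proof.
apply/existsP/existsP => [[i /existsP[j /andP[/eqP xij /existsP[y /andP[/eqP yij fy]]]]]|].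
  by exists y; rewrite fy andbT yij; apply/eqP; lia.
move=> [y /andP[/eqP yx fy]].
have T0 : (0 < phase_length b N)%N by have := ltn_ord y; lia.
have yi : (y %/ phase_length b N < phase_count N)%N by rewrite ltn_divLR.
have yj : (y %% phase_length b N < phase_length b N)%N by rewrite ltn_mod.
exists (Ordinal yi); apply/existsP; exists (Ordinal yj) => /=.
rewrite addnS -divn_eq -yx eqxx /=; apply/existsP; exists y.
by rewrite fy andbT /= -divn_eq.
Qed.

(* If every [v]-transmission of the window collided, then, each of the at most
   k - 1 other stations accounting for fewer than n/k of the n transmissions,
   they could not cover all of them. *)
Lemma sparse_collisions_success (R : realType) (b : R) (N k : nat)
    (f : {ffun 'I_N -> {ffun 'I_(phase_count N * phase_length b N) -> bool}})
    (A : {set 'I_N}) (tau : 'I_N -> nat) (v : 'I_N) :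
  let T := phase_length b N in
  sparse_collisions T f -> (1 < N)%N -> (k <= N)%N -> (#|A| <= k)%N ->
  v \in A ->
  exists2 x, (x < 12 * k ^ 2 * T)%N &
    transmits_successfully (schedule_of_bits f) A tau v (tau v + x).
Proof.
move=> T sparse N1 kN Ak vA; set P := (phase_count N * T)%N in f sparse *.
have k0 : (0 < k)%N by apply: leq_trans Ak; rewrite card_gt0; apply/set0Pn; exists v.
pose V := [pred x : 'I_P | window T k x && f v x].
pose M s u := [pred x : 'I_P | [&& window T k x, f v x & hits (matched s) (f u) x]].
pose sh u := minn (tau v + P - tau u) (2 * P).
have MV u : u != v -> (k * #|M (sh u) u| < #|V|)%N.
  by move=> uv; apply: sparse; rewrite ?geq_minr ?k0.
have V0 : (0 < #|V|)%N.
  have [u uv] : exists u : 'I_N, u != v.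
    have /card_gt1P[u1 [u2 [_ _ u12]]] : (1 < #|'I_N|)%N by rewrite card_ord.
    by have [e|?] := eqVneq u1 v; [exists u2; rewrite -e eq_sym|exists u1].
  exact: leq_ltn_trans (MV u uv).
(* If [u] transmits in this round, both local positions are below [P], so neither the truncated
   subtraction nor the cap in [sh] takes effect. *)
have tr u (x : 'I_P) : transmits (schedule_of_bits f) A tau u (tau v + x) ->
    hits (matched (sh u)) (f u) x.
  move=> /and3P[_ ux]; rewrite transmits_local_bits => /existsP[y /andP[/eqP yx fy]].
  apply/existsP; exists y; rewrite fy andbT /matched /sh; apply/eqP.
  have yP : (y < P)%N := ltn_ord y.
  move: ux yx yP (ltn_ord x); move: (nat_of_ord y) (nat_of_ord x) => m n.
  by move: (P) => Q; lia.
case: (boolP [exists x in V, [forall u, (u != v) ==>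
    ~~ transmits (schedule_of_bits f) A tau u (tau v + x)]]) => [|none].
  move=> /existsP[x /andP[/andP[/andP[_ xT] fx] alone]].
  exists x => //; rewrite /transmits_successfully alone andbT /transmits vA leq_addr.
  rewrite addKn transmits_local_bits; apply/existsP; exists x.
  by rewrite eqxx.
have cover : (#|V| <= \sum_(u in A :\ v) #|M (sh u) u|)%N.
  under eq_bigr do rewrite -sum1_card.
  rewrite (exchange_big_dep V) /= => [|u x _]; last by case/and3P => ? ? _; apply/andP.
  rewrite -sum1_card; apply: leq_sum => x xV.
  move: none; rewrite negb_exists => /forallP/(_ x); rewrite negb_and xV /=.
  rewrite negb_forall => /existsP[u]; rewrite negb_imply negbK => /andP[uv tu].
  rewrite (bigD1 u) //= !inE uv; have /andP[uA _] := tu; rewrite uA /=.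
  by case/andP: xV => -> ->; rewrite tr.
(* With at most k - 1 stations in [A :\ v], this contradicts [V0]. *)
have : (k * #|V| <= #|A :\ v| * #|V|)%N.
  apply: leq_trans (leq_mul (leqnn k) cover) _.
  rewrite big_distrr /= -sum_nat_const; apply: leq_sum => u.
  by rewrite !inE => /andP[uv _]; apply/ltnW/MV.
have AE := cardsD1 v A; rewrite vA add1n in AE.
by rewrite leq_mul2r -leqn0 leqNgt V0 /= leqNgt (leq_trans _ Ak) ?AE.
Qed.

(** * Choice of the constants *)

Lemma natX_expRN_le1 (R : realType) (N n : nat) (x : R) : (0 < N)%N ->
  n%:R * ln N%:R <= x -> N%:R ^+ n * expR (- x) <= 1.
Proof.
move=> N0 le_x; rewrite -[X in X ^+ n](@lnK R) ?posrE ?ltr0n //.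
by rewrite -expRM_natl -expRD -[leRHS]expR0 ler_expR subr_le0.
Qed.

Theorem theorem1p3 (R : realType) :
  exists (b C : R) (k0 N0 : nat),
    [/\ 0 < b, 0 < C &
      forall N : nat, (N0 <= N)%N ->
      exists S : schedule b N,
      forall k : nat, (k0 <= k)%N -> (k <= N)%N ->
      forall (A : {set 'I_N}) (tau : 'I_N -> nat), (#|A| <= k)%N ->
      forall v : 'I_N, v \in A ->
        succeeds_within S A tau v (C * k%:R ^+ 2 * ln N%:R)].
Proof.
(* With b = 256, T/32 >= 8 ln N, so exp (- T/32) <= N^(-8), while N >= 256 gives T <= N^2 and fewer
   than N^8 conditions. C = 12 * 257, because T <= 256 ln N + 1 <= 257 ln N. *)
exists 256, 3084, 0%N, 256%N; split=> // N N256.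
have N256R : (256 : R) <= N%:R by rewrite ler_nat.
set T := phase_length (256 : R) N.
have lnN : ln N%:R <= N%:R - 1 :> R.
  by have := @le_ln1Dx R (N%:R - 1); rewrite subrKC; apply; lra.
(* From exp (1/2) <= 2 one gets e <= 4 <= N. *)
have ln1 : 1 <= ln N%:R :> R.
  rewrite -ler_expR lnK ?posrE; last by lra.
  have half : expR 2^-1 <= 2 :> R.
    by apply: le_trans (expR_le1D2x _) _; [apply/andP; split; lra|lra].
  rewrite (_ : expR 1 = expR 2^-1 ^+ 2).
    by have := expR_gt0 (2^-1 : R); nra.
  by rewrite -expRM_natr mulVf ?pnatr_eq0.
have T_itv : 256 * ln N%:R <= T%:R :> R /\ T%:R <= 256 * ln N%:R + 1 :> R.
  have c0 : (0 <= Num.ceil (256 * ln N%:R : R))%R by rewrite ceil_ge0; lra.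
  have -> : T%:R = (Num.ceil (256 * ln N%:R : R))%:~R :> R.
    by rewrite /T /phase_length natr_absz ger0_norm.
  have /andP[h1 h2] := ceil_itv (256 * ln N%:R : R).
  by split=> //; move: h1; rewrite intrD; lra.
have [T1 T2] := T_itv.
have T0 : (0 < T)%N by rewrite -(@ltr0n R); lra.
have [||f sparse] := @exists_sparse_collisions R N T (phase_count N * T) T0.
- by rewrite /phase_count leq_mul2r leq_mul2r !orbT.
- have TN : T%:R <= 256 * N%:R :> R by lra.
  have : (N ^ 3 * (2 * (phase_count N * T) + 1))%:R < N%:R ^+ 8 :> R.
    rewrite -natrX ltr_nat; move: TN; rewrite -natrM ler_nat => TN.
    have TNN : (T <= N ^ 2)%N by apply: leq_trans TN _; rewrite -mulnn leq_mul2r N256 orbT.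
    have -> : (N ^ 8 = N ^ 3 * (N ^ 5))%N by rewrite -expnD.
    rewrite ltn_pmul2l ?expn_gt0; last by lia.
    have : (N * N ^ 4 = N ^ 5)%N by rewrite -expnS.
    have -> : (phase_count N * T = 16 * (N ^ 2 * T))%N by rewrite mulnA.
    have : (N ^ 2 * T <= N ^ 4)%N.
      by rewrite (_ : 4 = 2 + 2)%N // expnD leq_mul2l TNN orbT.
    have : (256 * N ^ 4 <= N * N ^ 4)%N by rewrite leq_mul2r N256 orbT.
    have : (0 < N ^ 4)%N by rewrite expn_gt0; lia.
    by lia.
  rewrite -(ltr_pM2r (expR_gt0 (- (T%:R / 32)))) => /lt_le_trans; apply.
  by apply: natX_expRN_le1; [lia|lra].
have N1 : (1 < N)%N by lia.
exists (schedule_of_bits f) => k _ kN A tau Ak v vA.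
have [x xk succ] := sparse_collisions_success tau sparse N1 kN Ak vA.
(* Position [x] is 0-based, so it is local round x + 1 <= 12 k^2 T. *)
exists x.+1; split=> //; last by rewrite addnS subn1.
apply: (@le_trans _ _ (12 * k ^ 2 * T)%:R); first by rewrite ler_nat.
rewrite natrM [(12 * _)%:R]natrM natrX.
have k2 : 0 <= k%:R ^+ 2 :> R by rewrite sqr_ge0.
nra.
Qed.
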